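(* Consider the pricing problem with procurement cost $c>0$, i.e. $\mathcal{Z}=(c,\infty)$ and $r(z)=z-c$. Let $\gamma\ge 0$. Suppose that the mean demand curve $y(z)$ is non-increasing and linear (affine) in $z$ on $\mathcal{Z}$ and that the confounding error satisfies $|E(z)|/y_0\le\gamma$ for all $z\in\mathcal{Z}$. Then $$1-4\gamma-4\gamma^{3/2}-\gamma^2\;\le\;\frac{R(\tilde z)}{R(z^\star)}\;\le\;1 .$$
   Context: $Z$ is a $\mathcal{Z}$-valued random variable (the historical price), $Y(z)$, $z\in\mathcal{Z}$, are real random variables (the random demand curve), and $Y=Y(Z)$ is the observed demand. Define $y(z)=\mathbb{E}[Y(z)]$ (mean demand curve), $\tilde y(z)=\mathbb{E}[Y\mid Z=z]$ (viewed as a fixed function on $\mathcal{Z}$), $R(z)=r(z)y(z)$ and $\tilde R(z)=r(z)\tilde y(z)$. Let $\epsilon(z)=Y(z)-y(z)$ and $\epsilon=\epsilon(Z)=Y-y(Z)$. The confounding error is $E(z)=\tilde y(z)-y(z)=\mathbb{E}[\epsilon\mid Z=z]$. The size of the market is $y_0=\sup_{z\in\mathcal{Z}}y(z)$. The optimizers $z^\star\in\arg\max_{z\in\mathcal{Z}}R(z)$ and $\tilde z\in\arg\max_{z\in\mathcal{Z}}\tilde R(z)$ are assumed to exist; $\tilde z$ is any such maximizer.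
   Formalization: For γ > 1 the lower bound is claimed only when y(z̃) ≥ 0, as it fails otherwise (c = 1, γ = 4, y(z) = 2 − z, E(6) = 4, E = −4 elsewhere: ratio −80 < −63); y₀ ≠ 0 is assumed so that |E(z)|/y₀ is defined. *)

(* Defs.v *)
From HB Require Import structures.
From mathcomp Require Import all_boot all_order all_algebra.
From mathcomp Require Import all_classical all_reals all_analysis.

Set Implicit Arguments.
Unset Strict Implicit.
Unset Printing Implicit Defensive.

Import Order.TTheory GRing.Theory Num.Theory.
Import numFieldNormedType.Exports.

Local Open Scope classical_set_scope.
Local Open Scope ring_scope.

Definition price_set (R : realType) (c : R) : set R := `]c, +oo[.

Definition margin (R : realType) (c : R) : R -> R := fun z => z - c.

Definition nonincreasing_on (R : realType) (D : set R) (f : R -> R) : Prop :=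
  forall z w, D z -> D w -> z <= w -> f w <= f z.

Definition affine_on (R : realType) (D : set R) (f : R -> R) : Prop :=
  exists a b : R, forall z, D z -> f z = a + b * z.

Definition is_argmax (R : realType) (D : set R) (f : R -> R) (z : R) : Prop :=
  D z /\ forall w, D w -> f w <= f z.

Definition revenue (R : realType) (r y : R -> R) : R -> R :=
  fun z => r z * y z.

Definition market_size (R : realType) (D : set R) (y : R -> R) : R :=
  sup [set y z | z in D].

Definition confounding_error (R : realType) (ytilde y : R -> R) : R -> R :=
  fun z => ytilde z - y z.

(* The curve [Y z] is a random variable for each fixed [z]; the observed
   demand evaluates it at the random historical price. *)
Definition observed_demand (T : Type) (R : realType)
    (Z : T -> R) (Y : R -> T -> R) : T -> R :=
  fun t => Y (Z t) t.

(* [fine] is harmless whenever [Y z] is integrable. *)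
Definition mean_demand (d : measure_display) (T : measurableType d)
    (R : realType) (P : probability T R) (Y : R -> T -> R) : R -> R :=
  fun z => fine ('E_P[Y z])%E.

(* [g] is a version of the regression function z |-> E[X | Z = z] on [D],
   i.e. g(Z) is a conditional expectation of X given sigma(Z), whose elements
   are the events Z^-1(B) with B Borel. Such a [g] is determined only up to a
   null set for the law of Z. *)
Definition is_regression (d : measure_display) (T : measurableType d)
    (R : realType) (P : probability T R) (D : set R)
    (Z X : T -> R) (g : R -> R) : Prop :=
  [/\ measurable_fun D g,
      P.-integrable setT (fun t => (g (Z t))%:E) &
      forall B : set R, measurable B ->
        (\int[P]_(t in Z @^-1` B) (g (Z t))%:E =
         \int[P]_(t in Z @^-1` B) (X t)%:E)%E].

(* Main.v *)
Require Import Defs.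
From HB Require Import structures.
From mathcomp Require Import all_boot all_order all_algebra.
From mathcomp Require Import all_classical all_reals all_analysis.
From mathcomp Require Import ring lra.
Import Order.TTheory GRing.Theory Num.Theory.
Import numFieldNormedType.Exports.
Local Open Scope classical_set_scope.
Local Open Scope ring_scope.

(** The market is described by a line.  In terms of the mark-up [u = z - c] the
mean demand is [A + b * u] with [b <= 0], and [A] is the market size, because
the supremum over the open half-line is the limit at [c].  A maximizer of
[u * (A + b * u)] over [u > 0] can exist only for [b < 0 < A] (the case
[A = b = 0] being excluded by a nonzero market size), and then it is
[- A / (2 * b)].

Measure prices by [s = u / u*], where [u*] is that optimal mark-up, and
revenues by the optimal revenue.  The true revenue becomes [s * (2 - s)], and
an error of at most [gamma * A] on the demand becomes an error of at most
[2 * gamma * s] on the revenue.  Since [s~] maximizes the perturbed revenue, it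
does at least as well as every competitor [x]:
[x * (2 - x) - 2 * gamma * x <= s~ * (2 - s~) + 2 * gamma * s~].
The best competitor is not the true optimum [x = 1] but [x = 1 - gamma], which
maximizes the left-hand side; it yields [|s~ - (1 + gamma)| <= 2 * sqrt gamma],
hence [|s~ - 1| <= gamma + 2 * sqrt gamma].  Finally
[s~ * (2 - s~) = 1 - (s~ - 1) ^+ 2 >= 1 - (gamma + 2 * sqrt gamma) ^+ 2], and
expanding the square gives the bound.

The competitor [1 - gamma] is an admissible price for [gamma < 1], and a limit
of admissible prices for [gamma = 1].  For larger [gamma] the bound is negative
while a nonnegative demand at [ztilde] makes the ratio nonnegative. *)

(** An affine function is continuous, so removing the endpoint [c] does not
lower its supremum. *)
Lemma market_size_affine (R : realType) (c a b : R) (y : R -> R) :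
  b <= 0 -> (forall z, price_set c z -> y z = a + b * z) ->
  market_size (price_set c) y = a + b * c.
Proof.
move=> b_le0 yE.
have ub_y : ubound [set y z | z in price_set c] (a + b * c).
  move=> _ [z Dz <-]; rewrite (yE z Dz).
  move: Dz; rewrite /price_set /= in_itv /= andbT => c_lt_z; nra.
apply/eqP; rewrite eq_le; apply/andP; split.
  apply: ge_sup => //; exists (y (c + 1)), (c + 1) => //.
  by rewrite /price_set /= in_itv /= andbT ltrDl.
apply/ler_addgt0Pr => e e_gt0.
have slope_gt0 : 0 < 1 - b by lra.
(* Any step [t] with [- b * t <= e] would do; this one also covers [b = 0]. *)
have t_gt0 : 0 < e / (1 - b) by rewrite divr_gt0.
have Dt : price_set c (c + e / (1 - b)).
  by rewrite /price_set /= in_itv /= andbT ltrDl.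
have : y (c + e / (1 - b)) <= market_size (price_set c) y.
  by apply: ub_le_sup; [exists (a + b * c) | exists (c + e / (1 - b))].
rewrite (yE _ Dt).
have : (1 - b) * (e / (1 - b)) = e by field; rewrite gt_eqF.
by nra.
Qed.

Lemma nonincreasing_affine_slope (R : realType) (c a b : R) (y : R -> R) :
  nonincreasing_on (price_set c) y ->
  (forall z, price_set c z -> y z = a + b * z) -> b <= 0.
Proof.
move=> y_mono yE.
have D1 : price_set c (c + 1) by rewrite /price_set /= in_itv /= andbT ltrDl.
have D2 : price_set c (c + 2) by rewrite /price_set /= in_itv /= andbT ltrDl.
have := y_mono _ _ D1 D2; rewrite (yE _ D1) (yE _ D2); lra.
Qed.

(** Halving or doubling the mark-up would improve the revenue if one of the
strict inequalities failed; then completing the square locates the maximizer. *)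
Lemma affine_revenue_argmax (R : realFieldType) (A b u : R) :
  b <= 0 -> A != 0 -> 0 < u ->
  (forall v, 0 < v -> v * (A + b * v) <= u * (A + b * u)) ->
  [/\ b < 0, 0 < A & A = - (2 * b * u)].
Proof.
move=> b_le0 A_neq0 u_gt0 u_max.
have half : 0 <= A / 2 + 3 / 4 * (b * u).
  have := u_max (u / 2) ltac:(lra).
  rewrite -subr_ge0.
  have -> : u * (A + b * u) - u / 2 * (A + b * (u / 2)) =
            u * (A / 2 + 3 / 4 * (b * u)) by field.
  by rewrite pmulr_rge0.
have b_lt0 : b < 0.
  rewrite lt_neqAle b_le0 andbT; apply/eqP => b0.
  have := u_max (2 * u) ltac:(lra); rewrite b0 !mul0r !addr0.
  move: half; rewrite b0 mul0r mulr0 addr0 => half.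
  have A_gt0 : 0 < A by rewrite lt_neqAle eq_sym A_neq0 /=; lra.
  by have := mulr_gt0 u_gt0 A_gt0; lra.
have bu_lt0 : b * u < 0 by rewrite pmulr_llt0.
have A_gt0 : 0 < A by lra.
split=> //.
have v_gt0 : 0 < - A / (2 * b) by rewrite nmulr_rgt0 ?invr_lt0; lra.
have := u_max _ v_gt0; rewrite -subr_ge0.
have -> : u * (A + b * u) - - A / (2 * b) * (A + b * (- A / (2 * b))) =
          (A + 2 * b * u) ^+ 2 / (4 * b) by field; rewrite lt_eqF.
rewrite nmulr_lge0; last by rewrite invr_lt0; lra.
move=> sq_le0.
have : (A + 2 * b * u) ^+ 2 == 0 by rewrite eq_le sq_le0 sqr_ge0.
by rewrite sqrf_eq0 => /eqP; lra.
Qed.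

(** Evaluation at the best competitor [x = 1 - gamma]; for [gamma = 1] it is not
positive, and [x] tends to [0] instead. *)
Lemma perturbed_argmax_quadratic (R : realFieldType) (gamma s : R) :
  gamma <= 1 ->
  (forall x, 0 < x ->
    x * (2 - x) - 2 * gamma * x <= s * (2 - s) + 2 * gamma * s) ->
  (1 - gamma) ^+ 2 <= s * (2 - s) + 2 * gamma * s.
Proof.
move=> gamma_le1 s_max.
have [gamma_lt1|] := ltP gamma 1.
  by have := s_max (1 - gamma) ltac:(lra); nra.
move=> gamma_ge1.
have gamma1 : gamma = 1 by apply/eqP; rewrite eq_le gamma_le1.
rewrite gamma1 subrr expr0n /=; rewrite gamma1 in s_max.
apply/ler_addgt0Pr => e e_gt0.
have m_gt0 : 0 < Num.min 1 e by rewrite lt_min ltr01.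
have m_le1 : Num.min 1 e <= 1 by rewrite ge_min lexx.
have m_lee : Num.min 1 e <= e by rewrite ge_min lexx orbT.
have := s_max _ m_gt0; nra.
Qed.

(** With [g] the square root of the relative error, the discriminant
[(1 + g ^+ 2) ^+ 2 - (1 - g ^+ 2) ^+ 2] of the quadratic inequality is the
square of [2 * g], so [s] is within [2 * g] of [1 + g ^+ 2]. *)
Lemma perturbed_argmax_ratio (R : realFieldType) (g s : R) :
  0 <= g -> g <= 1 ->
  (forall x, 0 < x ->
    x * (2 - x) - 2 * g ^+ 2 * x <= s * (2 - s) + 2 * g ^+ 2 * s) ->
  1 - (g ^+ 2 + 2 * g) ^+ 2 <= s * (2 - s).
Proof.
move=> g_ge0 g_le1 s_max.
have g2_le1 : g ^+ 2 <= 1 by rewrite expr_le1.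
have := perturbed_argmax_quadratic _ _ _ g2_le1 s_max.
have g2_ge0 := sqr_ge0 g.
move=> quad.
have sq : (s - (1 + g ^+ 2)) ^+ 2 <= (2 * g) ^+ 2 by nra.
have /andP[lo hi] : - (2 * g) <= s - (1 + g ^+ 2) <= 2 * g.
  rewrite -ler_norml -(@ler_pXn2r _ 2) ?nnegrE ?normr_ge0 //; last lra.
  by rewrite real_normK ?num_real.
have : (s - 1) ^+ 2 <= (g ^+ 2 + 2 * g) ^+ 2.
  rewrite -[X in X <= _]real_normK ?num_real //.
  rewrite ler_pXn2r ?nnegrE ?normr_ge0 //; last lra.
  by rewrite ler_norml; apply/andP; split; lra.
by nra.
Qed.

Lemma powR_three_halves (R : realType) (x : R) :
  0 <= x -> x `^ (3 / 2) = Num.sqrt x ^+ 3.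
Proof.
move=> x_ge0.
by rewrite -powR12_sqrt // -powR_mulrn ?powR_ge0 // -powRrM mulrC.
Qed.

Theorem theorem2 (R : realType) (d : measure_display) (T : measurableType d)
    (P : probability T R) (c gamma : R)
    (Z : {RV P >-> R}) (Y : R -> {RV P >-> R}) (ytilde : R -> R)
    (zstar ztilde : R)
    (D := price_set c) (r := margin c)
    (Yobs := observed_demand Z (fun z => Y z))
    (y := mean_demand P (fun z => Y z))
    (y0 := market_size D y)
    (E := confounding_error ytilde y)
    (Rev := revenue r y) (Revtilde := revenue r ytilde)
    (hc : 0 < c) (hgamma : 0 <= gamma)
    (hZ : forall t, D (Z t))
    (hY : forall z, D z -> P.-integrable setT (fun t => (Y z t)%:E))
    (hYobs : P.-integrable setT (fun t => (Yobs t)%:E))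
    (hytilde : is_regression P D Z Yobs ytilde)
    (hmono : nonincreasing_on D y)
    (haff : affine_on D y)
    (hy0 : y0 != 0)
    (hE : forall z, D z -> `|E z| / y0 <= gamma)
    (hzstar : is_argmax D Rev zstar)
    (hztilde : is_argmax D Revtilde ztilde) :
  (gamma <= 1 \/ 0 <= y ztilde ->
    1 - 4 * gamma - 4 * gamma `^ (3 / 2) - gamma ^+ 2
      <= Rev ztilde / Rev zstar)
  /\ Rev ztilde / Rev zstar <= 1.
Proof.
have Du u : 0 < u -> D (c + u).
  by move=> u_gt0; rewrite /D /price_set /= in_itv /= andbT ltrDl.
have uD z : D z -> 0 < z - c.
  by rewrite /D /price_set /= in_itv /= andbT subr_gt0.
have [a [b yE]] := haff.
have b_le0 : b <= 0 := nonincreasing_affine_slope _ _ _ _ _ hmono yE.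
have y0E : y0 = a + b * c := market_size_affine _ _ _ _ _ b_le0 yE.
have yu u : 0 < u -> y (c + u) = y0 + b * u.
  by move=> u_gt0; rewrite yE ?y0E; [ring | exact: Du].
have [Dstar star_max] := hzstar; have [Dtilde tilde_max] := hztilde.
set us := zstar - c; set ut := ztilde - c.
have us_gt0 : 0 < us := uD _ Dstar.
have ut_gt0 : 0 < ut := uD _ Dtilde.
have RevE u : 0 < u -> Rev (c + u) = u * (y0 + b * u).
  by move=> u_gt0; rewrite /Rev /revenue yu // /r /margin [c + u]addrC addrK.
have zsE : zstar = c + us by rewrite addrC subrK.
have ztE : ztilde = c + ut by rewrite addrC subrK.
have us_max v : 0 < v -> v * (y0 + b * v) <= us * (y0 + b * us).
  by move=> v_gt0; rewrite -!RevE // -zsE; apply: star_max; apply: Du.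
have [b_lt0 y0_gt0 y0us] :=
  affine_revenue_argmax _ _ _ _ b_le0 hy0 us_gt0 us_max.
have RevsE : Rev zstar = - b * us ^+ 2 by rewrite zsE RevE // y0us; ring.
have Revs_gt0 : 0 < Rev zstar.
  by rewrite RevsE mulr_gt0 ?oppr_gt0 ?exprn_gt0.
split; last by rewrite ler_pdivrMr // mul1r; apply: star_max.
set s := ut / us.
have utE : ut = s * us by rewrite /s divfK // gt_eqF.
have s_gt0 : 0 < s by rewrite divr_gt0.
have ratioE : Rev ztilde / Rev zstar = s * (2 - s).
  rewrite RevsE ztE RevE // y0us utE; field.
  by rewrite gt_eqF // lt_eqF.
have gE : gamma = Num.sqrt gamma ^+ 2 by rewrite sqr_sqrtr.
have g_ge0 : 0 <= Num.sqrt gamma by exact: sqrtr_ge0.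
have -> : 1 - 4 * gamma - 4 * gamma `^ (3 / 2) - gamma ^+ 2 =
          1 - (Num.sqrt gamma ^+ 2 + 2 * Num.sqrt gamma) ^+ 2.
  by rewrite powR_three_halves // [in LHS]gE sqrtr_sqr ger0_norm //; ring.
(* For [gamma > 1] the bound is below [1 - 3 ^+ 2]. *)
have [gamma_le1 _|gamma_gt1] := leP gamma 1; last first.
  case=> [//|yt_ge0].
  apply: (@le_trans _ _ 0); first by rewrite -gE; nra.
  by rewrite divr_ge0 ?(ltW Revs_gt0) // mulr_ge0 // ltW.
rewrite ratioE; apply: perturbed_argmax_ratio => //.
  by rewrite -sqrtr1 ler_wsqrtr.
rewrite -gE => x x_gt0.
have err z : D z -> `|ytilde z - y z| <= gamma * y0.
  by move=> Dz; rewrite -ler_pdivrMr //; exact: hE.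
have xus_gt0 : 0 < x * us by rewrite mulr_gt0.
have /ler_normlP[lo _] := err _ (Du _ xus_gt0).
have /ler_normlP[_ hi] := err _ Dtilde.
have := tilde_max _ (Du _ xus_gt0).
rewrite /Revtilde /revenue /r /margin [c + _ - c]addrC addKr -/ut.
move: lo hi; rewrite ztE !yu // => lo hi cmp.
have lo' : x * us * (y0 + b * (x * us) - gamma * y0) <=
           x * us * ytilde (c + x * us).
  by rewrite ler_wpM2l ?(ltW xus_gt0) //; lra.
have hi' : ut * ytilde (c + ut) <= ut * (y0 + b * ut + gamma * y0).
  by rewrite ler_wpM2l ?(ltW ut_gt0) //; lra.
have := le_trans lo' (le_trans cmp hi').
rewrite y0us utE => chain.
(* Both sides of [chain] are the normalized ones times the optimal revenue. *)
rewrite -(ler_pM2l Revs_gt0) RevsE.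
by lra.
Qed.
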